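(* Let $T:V\to L$ be an $\mathcal{O}$-operator on a LieRep pair $(L,[\cdot,\cdot];\rho)$, with $\rho:L\to End(V)$. Every $1$-cocycle for the cohomology of the $\mathcal{O}$-operator $T$ on the LieRep pair $(L,[\cdot,\cdot];\rho)$ is a $1$-cocycle for the cohomology of the $\mathcal{O}$-operator $T$ on the L.t.sRep pair $(L,[\cdot,\cdot,\cdot];\theta_\rho)$, where $[x,y,z]=[[x,y],z]$ and $\theta_\rho(x,y)=\rho(y)\rho(x)$.
   Context: All vector spaces are over a field of characteristic $0$. A LieRep pair $(L,[\cdot,\cdot];\rho)$ is a Lie algebra $L$ together with a representation $\rho:L\to End(V)$ on a vector space $V$. A linear map $T:V\to L$ is an $\mathcal{O}$-operator on it if $[Tu,Tv]=T\big(\rho(Tu)v-\rho(Tv)u\big)$ for all $u,v\in V$. Then $V$ is a Lie algebra under $[u,v]_T=\rho(Tu)v-\rho(Tv)u$, and $\rho_T(u)x=[Tu,x]+T\rho(x)u$ is a representation of it on $L$. The cohomology of $T$ on the LieRep pair is the Chevalley–Eilenberg cohomology of $(V,[\cdot,\cdot]_T)$ with coefficients in $(L,\rho_T)$; thus a $1$-cocycle is a linear map $f:V\to L$ with $\rho_T(u_1)f(u_2)-\rho_T(u_2)f(u_1)-f([u_1,u_2]_T)=0$ for all $u_1,u_2\in V$. With $[x,y,z]=[[x,y],z]$, $L$ is a Lie triple system and $\theta=\theta_\rho$ is a representation of it on $V$ (a L.t.sRep pair); put $D(x,y)=\theta(y,x)-\theta(x,y)$. $T$ is then also an $\mathcal{O}$-operator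 on this L.t.sRep pair, i.e. $[Tu,Tv,Tw]=T\big(D(Tu,Tv)w+\theta(Tv,Tw)u-\theta(Tu,Tw)v\big)$. Accordingly $V$ is a Lie triple system under $[u,v,w]_T=D(Tu,Tv)w+\theta(Tv,Tw)u-\theta(Tu,Tw)v$, with representation on $L$ given by $\theta_T(u,v)x=[x,Tu,Tv]+T\big(\theta(x,Tv)u-D(x,Tu)v\big)$; put $D_T(u,v)=\theta_T(v,u)-\theta_T(u,v)$. A $1$-cocycle for the cohomology of $T$ on the L.t.sRep pair is a linear map $f:V\to L$ with $D_T(v_1,v_2)f(v_3)-\theta_T(v_1,v_3)f(v_2)+\theta_T(v_2,v_3)f(v_1)-f([v_1,v_2,v_3]_T)=0$ for all $v_1,v_2,v_3\in V$. *)

(* Defs.v *)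
From HB Require Import structures.
From mathcomp Require Import all_boot all_order all_algebra.

Set Implicit Arguments.
Unset Strict Implicit.
Unset Printing Implicit Defensive.

Import GRing.Theory.
Local Open Scope ring_scope.

Definition trilinear (F : fieldType) (A B C W : lmodType F)
    (g : A -> B -> C -> W) : Prop :=
  [/\ forall y z, linear (fun x => g x y z),
      forall x z, linear (fun y => g x y z)
    & forall x y, linear (g x y)].

Record lieAlgebra (F : fieldType) (L : lmodType F) := LieAlgebra {
  lie_br :> {bilinear L -> L -> L};
  lie_brxx : forall x, lie_br x x = 0;
  lie_jacobi : forall x y z,
    lie_br x (lie_br y z) + lie_br y (lie_br z x) + lie_br z (lie_br x y) = 0
}.

(* A representation L -> End(V), given in curried form. *)
Record lieRep (F : fieldType) (L : lmodType F) (g : lieAlgebra L)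
    (V : lmodType F) := LieRep {
  lie_act :> {bilinear L -> V -> V};
  lie_actE : forall x y v,
    lie_act (g x y) v = lie_act x (lie_act y v) - lie_act y (lie_act x v)
}.

Record lieTripleSystem (F : fieldType) (L : lmodType F) := LieTripleSystem {
  lts_br :> L -> L -> L -> L;
  lts_trilinear : trilinear lts_br;
  lts_brxx : forall x y, lts_br x x y = 0;
  lts_cyclic : forall x y z, lts_br x y z + lts_br y z x + lts_br z x y = 0;
  lts_derivation : forall x y a b c,
    lts_br x y (lts_br a b c) =
      lts_br (lts_br x y a) b c + lts_br a (lts_br x y b) c
      + lts_br a b (lts_br x y c)
}.

Definition Dop (A W : Type) (Z : zmodType) (th : A -> A -> W -> Z)
    (x y : A) (v : W) : Z := th y x v - th x y v.

(* Yamaguti's axioms for a representation of a Lie triple system. *)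
Record ltsRep (F : fieldType) (L : lmodType F) (t : lieTripleSystem L)
    (V : lmodType F) := LtsRep {
  lts_act :> L -> L -> V -> V;
  lts_act_trilinear : trilinear lts_act;
  lts_act_theta : forall x y z w v,
    lts_act z w (lts_act x y v) - lts_act y w (lts_act x z v)
    - lts_act x (t y z w) v + Dop lts_act y z (lts_act x w v) = 0;
  lts_act_D : forall x y z w v,
    lts_act z w (Dop lts_act x y v) - Dop lts_act x y (lts_act z w v)
    + lts_act (t x y z) w v + lts_act z (t x y w) v = 0
}.

(* Kernel of the Chevalley-Eilenberg differential in degree 1, for the bracket
   [br] on [V] acting on [L] through [act]. *)
Definition lie_cocycle1 (V : Type) (L : zmodType) (br : V -> V -> V)
    (act : V -> L -> L) (f : V -> L) : Prop :=
  forall u1 u2 : V, act u1 (f u2) - act u2 (f u1) - f (br u1 u2) = 0.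

(* Kernel of the Yamaguti differential in degree 1, for the triple bracket [br]
   on [V] acting on [L] through [act]. *)
Definition lts_cocycle1 (V : Type) (L : zmodType) (br : V -> V -> V -> V)
    (act : V -> V -> L -> L) (f : V -> L) : Prop :=
  forall v1 v2 v3 : V,
    Dop act v1 v2 (f v3) - act v1 v3 (f v2) + act v2 v3 (f v1)
    - f (br v1 v2 v3) = 0.

Section OOperators.

Variables (F : fieldType) (L V : lmodType F).

Section Lie.

Variables (g : lieAlgebra L) (rho : lieRep g V).

Definition lie_brT (T : V -> L) (u v : V) : V := rho (T u) v - rho (T v) u.

Definition lie_actT (T : V -> L) (u : V) (x : L) : L :=
  g (T u) x + T (rho x u).

Record lieOoperator := LieOoperator {
  lieO_map :> {linear V -> L};
  lieO_eq : forall u v,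
    g (lieO_map u) (lieO_map v) = lieO_map (lie_brT lieO_map u v)
}.

Definition lieO_cocycle1 (T : lieOoperator) (f : {linear V -> L}) : Prop :=
  lie_cocycle1 (lie_brT T) (lie_actT T) f.

End Lie.

Section Lts.

Variables (t : lieTripleSystem L) (theta : ltsRep t V).

Definition lts_brT (T : V -> L) (u v w : V) : V :=
  Dop theta (T u) (T v) w + theta (T v) (T w) u - theta (T u) (T w) v.

Definition lts_actT (T : V -> L) (u v : V) (x : L) : L :=
  t x (T u) (T v) + T (theta x (T v) u - Dop theta x (T u) v).

Record ltsOoperator := LtsOoperator {
  ltsO_map :> {linear V -> L};
  ltsO_eq : forall u v w,
    t (ltsO_map u) (ltsO_map v) (ltsO_map w) =
    ltsO_map (lts_brT ltsO_map u v w)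
}.

Definition ltsO_cocycle1 (T : ltsOoperator) (f : {linear V -> L}) : Prop :=
  lts_cocycle1 (lts_brT T) (lts_actT T) f.

End Lts.

End OOperators.

Section LieToLts.

Variables (F : fieldType) (L : lmodType F) (g : lieAlgebra L).

Definition triple_br (x y z : L) : L := g (g x y) z.

Lemma lie_brC x y : g x y = - g y x.
Proof.
apply/eqP; rewrite -addr_eq0; apply/eqP.
by have := lie_brxx g (x + y);
  rewrite linearDl !linearDr !lie_brxx add0r addr0.
Qed.

Lemma lie_brA x y z : g (g x y) z = g x (g y z) - g y (g x z).
Proof.
have := lie_jacobi g x y z.
rewrite [g z (g x y)]lie_brC [g z x]lie_brC linearNr.
by move/eqP; rewrite subr_eq0 => /eqP.
Qed.

Fact triple_br_trilinear : trilinear triple_br.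
Proof.
by split=> x y a u v; rewrite /triple_br ?(linearPl, linearPr).
Qed.

Fact triple_brxx x y : triple_br x x y = 0.
Proof. by rewrite /triple_br lie_brxx linear0l. Qed.

Fact triple_br_cyclic x y z :
  triple_br x y z + triple_br y z x + triple_br z x y = 0.
Proof.
rewrite /triple_br [g (g x y) z]lie_brC [g (g y z) x]lie_brC.
by rewrite [g (g z x) y]lie_brC -!opprD -[RHS]oppr0 -(lie_jacobi g z x y).
Qed.

Fact triple_br_derivation x y a b c :
  triple_br x y (triple_br a b c) =
    triple_br (triple_br x y a) b c + triple_br a (triple_br x y b) c
    + triple_br a b (triple_br x y c).
Proof.
have der p q r : g p (g q r) = g (g p q) r + g q (g p r).
  by rewrite lie_brA subrK.
by rewrite /triple_br der der linearDl.
Qed.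

Definition lts_of_lie : lieTripleSystem L :=
  LieTripleSystem triple_br_trilinear triple_brxx triple_br_cyclic
    triple_br_derivation.

Variables (V : lmodType F) (rho : lieRep g V).

Definition theta_of (x y : L) (v : V) : V := rho y (rho x v).

Fact theta_of_trilinear : trilinear theta_of.
Proof.
by split=> x y a u v; rewrite /theta_of ?(linearPl, linearPr).
Qed.

Lemma Dop_theta_of x y v : Dop theta_of x y v = rho (g x y) v.
Proof. by rewrite /Dop /theta_of lie_actE. Qed.

Fact theta_of_theta x y z w v :
  theta_of z w (theta_of x y v) - theta_of y w (theta_of x z v)
  - theta_of x (lts_of_lie y z w) v + Dop theta_of y z (theta_of x w v) = 0.
Proof.
rewrite Dop_theta_of /theta_of /= /triple_br (lie_actE rho (g y z) w).
by rewrite opprB addrA subrK lie_actE linearBr subrKA subrr.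
Qed.

Fact theta_of_D x y z w v :
  theta_of z w (Dop theta_of x y v) - Dop theta_of x y (theta_of z w v)
  + theta_of (lts_of_lie x y z) w v + theta_of z (lts_of_lie x y w) v = 0.
Proof.
rewrite !Dop_theta_of /theta_of /= /triple_br !(lie_actE rho (g x y)).
by rewrite linearBr -addrA [X in _ + X]addrC !subrKA subrr.
Qed.

Definition ltsRep_of_lie : ltsRep lts_of_lie V :=
  LtsRep theta_of_trilinear theta_of_theta theta_of_D.

Variable T : lieOoperator rho.

Fact ltsO_of_lie_eq u v w :
  lts_of_lie (T u) (T v) (T w) = T (lts_brT ltsRep_of_lie T u v w).
Proof.
rewrite /= /triple_br !lieO_eq /lie_brT /lts_brT /= Dop_theta_of /theta_of.
by rewrite -/(lie_brT rho T u v) -lieO_eq /lie_brT linearBr opprB addrA.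
Qed.

Definition ltsO_of_lie : ltsOoperator ltsRep_of_lie :=
  LtsOoperator ltsO_of_lie_eq.

End LieToLts.

(* Main.v *)
Require Import Defs.
From mathcomp Require Import all_boot all_order all_algebra.

(** Passing from a Lie algebra to its Lie triple system commutes with twisting
    by the O-operator [T].  Twisting gives the bracket [lie_brT rho T] on [V] and
    its representation [lie_actT rho T] on [L].  The triple bracket and the
    triple action that [T] induces are then [br (br u v) w] and
    [act v (act u x)], where [br] and [act] are this twisted bracket and this
    twisted action ([lts_brT_of_lie], [lts_actT_of_lie]).

    So the theorem reduces to a fact about a bracket and an action by
    commutators ([lie_cocycle1_lts]).  A 1-cocycle is a derivation with values
    in the module, and applying the derivation rule twice to [br (br u v) w]
    gives
      [act (br u v) (f w) - act w (act u (f v) - act v (f u))].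
    This is the triple cocycle identity, because [act (br u v)] is the
    commutator of [act u] and [act v].  That the twisted action has this last
    property is [lie_actT_rep]. *)

Import GRing.Theory.
Local Open Scope ring_scope.

(** Both triple-cocycle terms built from [f w] come from the commutator
    [act (br u v)], and the other two from [act w] applied to
    [f (br u v)]. *)
Lemma lie_cocycle1_lts (V : Type) (L : zmodType) (br : V -> V -> V)
    (act : V -> L -> L) (f : V -> L) :
  (forall u, zmod_morphism (act u)) ->
  (forall u v x, act (br u v) x = act u (act v x) - act v (act u x)) ->
  lie_cocycle1 br act f ->
  lts_cocycle1 (fun u v w => br (br u v) w) (fun u v x => act v (act u x)) f.
Proof.
move=> actB act_br f_cocycle u v w.
have f_br a b : f (br a b) = act a (f b) - act b (f a).
  by apply/eqP; rewrite eq_sym -subr_eq0; apply/eqP.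
rewrite /Dop !f_br act_br actB.
by apply/eqP; rewrite subr_eq0 opprB addrA addrAC.
Qed.

Section Twist.

Variables (F : fieldType) (L V : lmodType F) (g : lieAlgebra L).
Variables (rho : lieRep g V) (T : lieOoperator rho).

Lemma lie_actTB u : zmod_morphism (lie_actT rho T u).
Proof.
move=> x y.
by rewrite /lie_actT linearBr linearBl linearB /= opprD addrACA.
Qed.

(** The O-operator identity for [g (T v) (T (rho x u))] produces a term
    [T (rho (T (rho x u)) v)] that cancels the one in which [rho] is applied to
    the [T]-part of [lie_actT rho T u x]. *)
Lemma lie_actT_comp u v x :
  lie_actT rho T v (lie_actT rho T u x) =
    g (T v) (g (T u) x) + T (rho (T v) (rho x u) + rho (g (T u) x) v).
Proof.
rewrite /lie_actT linearDr lieO_eq linearDl /lie_brT -addrA -linearD.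
by rewrite [_ + rho (T _) v]addrC addrA subrK.
Qed.

(** By [lie_actT_comp], the [L]-parts form the Jacobi identity and the
    arguments of [T] agree because [rho] is a representation. *)
Lemma lie_actT_rep u v x :
  lie_actT rho T (lie_brT rho T u v) x =
    lie_actT rho T u (lie_actT rho T v x)
    - lie_actT rho T v (lie_actT rho T u x).
Proof.
rewrite !lie_actT_comp opprD addrACA -lie_brA -linearB.
rewrite {1}/lie_actT -lieO_eq; congr (_ + T _).
rewrite !lie_actE /lie_brT linearBr.
by rewrite addrCA opprD addrACA subrr add0r opprB addrC subrKA.
Qed.

Lemma lts_brT_of_lie u v w :
  lts_brT (ltsRep_of_lie rho) T u v w =
    lie_brT rho T (lie_brT rho T u v) w.
Proof.
rewrite /lts_brT /= Dop_theta_of /theta_of [RHS]/lie_brT -lieO_eq.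
by rewrite /lie_brT linearBr opprB addrA.
Qed.

Lemma lts_actT_of_lie u v x :
  lts_actT (ltsRep_of_lie rho) T u v x =
    lie_actT rho T v (lie_actT rho T u x).
Proof.
rewrite lie_actT_comp /lts_actT /= /triple_br Dop_theta_of /theta_of.
by rewrite [g (g x _) _]lie_brC [g x _]lie_brC linearNr linearNl !opprK.
Qed.

End Twist.

Theorem corollary6p7 (F : fieldType) (char0 : [pchar F]%R =i pred0)
    (L V : lmodType F) (g : lieAlgebra L) (rho : lieRep g V)
    (T : lieOoperator rho) (f : {linear V -> L}%R) :
  lieO_cocycle1 T f -> ltsO_cocycle1 (ltsO_of_lie T) f.
Proof.
move=> f_cocycle u v w.
have := @lie_cocycle1_lts _ _ _ (fun u => lie_actT rho T u) f
  (lie_actTB _ _ _ _ _ T) (lie_actT_rep _ _ _ _ _ T) f_cocycle u v w.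
by rewrite /Dop lts_brT_of_lie !lts_actT_of_lie.
Qed.
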